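(* Let $A$ be a commutative ring, let $x=(x_1,\dots,x_n)$ be a sequence of elements of $A$ generating the ideal $J_x$, and let $M$ be an $A$-module. (1) If $x$ is $M$-independent, then for any $\ell\in\{1,\dots,n\}$ we have \[ \operatorname{Ker} d^{x,M}_\ell\subset J_x\cdot K_\ell(x,M). \] More generally, for any submodule $N\subset M$ (and any $\ell\in\{1,\dots,n\}$), we have \[ (d^{x,M}_\ell)^{-1}(J_xK_{\ell-1}(x,N))\subset K_\ell(x,N)+J_xK_\ell(x,M). \] (2) Conversely, if $\operatorname{Ker} d^{x,M}_1\subset J_x\cdot K_1(x,M)$, then the sequence $x$ is $M$-independent.
   Context: A sequence $x_1,\dots,x_n$ of elements of $A$ is $M$-independent if for all $m_1,\dots,m_n\in M$, $\sum_i x_im_i=0$ implies $m_i\in(x_1,\dots,x_n)M$ for every $i$. $K(x)$ is the Koszul complex: $K_\ell(x)=\Lambda^\ell(A^n)$, with basis $e_{i_1}\wedge\dots\wedge e_{i_\ell}$ ($i_1<\dots<i_\ell$), where $(e_1,\dots,e_n)$ is the canonical basis of $A^n$, and differential $d^x_\ell:K_\ell(x)\to K_{\ell-1}(x)$ given by $d^x_\ell(e_{i_1}\wedge\dots\wedge e_{i_\ell})=\sum_{j=1}^\ell(-1)^{j-1}x_{i_j}\,e_{i_1}\wedge\dots\wedge\widehat{e_{i_j}}\wedge\dots\wedge e_{i_\ell}$. For an $A$-module $M$, $K(x,M)=K(x)\otimes_AM$, with $\ell$-th differential $d^{x,M}_\ell$. For a submodule $N\subset M$, $K_\ell(x,N)$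 is viewed as a submodule of $K_\ell(x,M)$ (the modules $K_\ell(x)$ are free). *)

(* Defs.v *)
From mathcomp Require Import all_boot all_order all_fingroup all_algebra.
From mathcomp Require Import boolp classical_sets.

Set Implicit Arguments.
Unset Strict Implicit.
Unset Printing Implicit Defensive.

Import GRing.Theory.
Local Open Scope ring_scope.
Local Open Scope classical_set_scope.

Definition is_submodule (A : pzRingType) (M : lmodType A) (N : set M) : Prop :=
  submod_closed [in N].

Definition add_set (A : pzRingType) (M : lmodType A) (N P : set M) : set M :=
  [set w | exists u v, [/\ N u, P v & w = u + v]].

(* [ideal_mul J N] is the submodule [J N]: finite sums of products [a *: u]. *)
Definition ideal_mul (A : pzRingType) (M : lmodType A)
    (J : set A) (N : set M) : set M :=
  [set w | exists k (a : 'I_k -> A) (u : 'I_k -> M),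
     [/\ forall i, J (a i), forall i, N (u i) & w = \sum_i a i *: u i]].

Section Sequences.
Variables (A : comPzRingType) (n : nat) (x : n.-tuple A).

Definition ideal_gen : set A :=
  [set a | exists c : 'I_n -> A, a = \sum_i c i * tnth x i].

Definition independent (M : lmodType A) : Prop :=
  forall m : 'I_n -> M, \sum_i tnth x i *: m i = 0 ->
  forall i, ideal_mul ideal_gen [set: M] (m i).

End Sequences.

Notation incr n l := {t : l.-tuple 'I_n | sorted ltn (map val t)}.

(* The free module on the symbols [e_(t_1) /\ ... /\ e_(t_l)], [t] increasing;
   [wedge_universal] below shows that, together with [wedge], it is the [l]-th
   exterior power of ['rV[A]_n]. *)
Notation exterior A n l := {ffun incr n l -> A^o}.

Section Exterior.
Variables (A : comPzRingType) (n l : nat).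

(* A family of [l] vectors of [A^n] is given by the rows of a matrix; the
   coordinates of its exterior product are the maximal minors of the matrix. *)
Definition wedge (v : 'M[A]_(l, n)) : exterior A n l :=
  [ffun t : incr n l => \det (colsub (tnth (val t)) v)].

Definition wedge_basis (t : 'I_l -> 'I_n) : exterior A n l :=
  wedge (rowsub t 1%:M).

Definition multilinear (V : lmodType A) (f : 'M[A]_(l, n) -> V) : Prop :=
  forall (u v w : 'M[A]_(l, n)) (i : 'I_l) (b c : A),
    row i u = b *: row i v + c *: row i w ->
    row' i v = row' i u -> row' i w = row' i u ->
    f u = b *: f v + c *: f w.

Definition alternating (V : lmodType A) (f : 'M[A]_(l, n) -> V) : Prop :=
  forall (v : 'M[A]_(l, n)) (i j : 'I_l), i != j -> row i v = row j v ->
    f v = 0.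

End Exterior.

Arguments wedge_basis A {n l} t.

Section Tensor.
Variables (A : comPzRingType) (B : finType) (M : lmodType A).

(* [{ffun B -> M}] together with [tens] is the tensor product of the free
   module [{ffun B -> A^o}] with [M]; see [tens_universal]. *)
Definition tens (c : {ffun B -> A^o}) (m : M) : {ffun B -> M} :=
  [ffun b => c b *: m].

Definition free_basis (b : B) : {ffun B -> A^o} := [ffun b' => (b' == b)%:R].

Definition bilinear (V : lmodType A) (g : {ffun B -> A^o} -> M -> V) : Prop :=
  (forall m, linear (fun c => g c m)) /\ (forall c, linear (g c)).

End Tensor.

(* [f] tensored with the identity of [M]; see [tens_map_tens]. *)
Definition tens_map (A : comPzRingType) (B C : finType)
    (f : {ffun B -> A^o} -> {ffun C -> A^o}) (M : lmodType A)
    (u : {ffun B -> M}) : {ffun C -> M} :=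
  \sum_b tens (f (free_basis A b)) (u b).

Section Koszul.
Variables (A : comPzRingType) (n : nat) (x : n.-tuple A).

(* [K_l(x)] is [exterior A n l]. For [l = 0] this is the zero map, the
   truncated target degree [0.-1 = 0] being irrelevant. *)
Definition koszul_diff (l : nat) (c : exterior A n l) : exterior A n l.-1 :=
  \sum_(t : incr n l) c t *:
    \sum_(j < l) ((-1) ^+ j * tnth x (tnth (val t) j)) *:
      wedge_basis A (fun i : 'I_l.-1 => tnth (val t) (lift j i)).

Variable M : lmodType A.

Definition koszul (l : nat) : lmodType A := {ffun incr n l -> M}.

Definition koszul_diffM (l : nat) : koszul l -> koszul l.-1 :=
  tens_map (@koszul_diff l) (M := M).

(* [K_l(x, N)] inside [K_l(x, M)]; see [koszul_subE]. *)
Definition koszul_sub (l : nat) (N : set M) : set (koszul l) :=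
  [set u : {ffun incr n l -> M} | forall t, N (u t)].

End Koszul.

Arguments koszul_diffM {A n} x M l.
Arguments koszul_sub {A} n {M} l N.

Lemma linear_combination (A : pzRingType) (U V : lmodType A) (h : U -> V)
    (I : Type) (r : seq I) (c : I -> A) (u : I -> U) :
  linear h -> h (\sum_(i <- r) c i *: u i) = \sum_(i <- r) c i *: h (u i).
Proof.
move=> hL; elim: r => [|i r IHr]; last by rewrite !big_cons hL IHr.
by rewrite !big_nil -[X in h X]addr0 -[X in h (X + _)](scaler0 _ (-1)) hL
  scaleN1r addNr.
Qed.

Section ExteriorTheory.
Variables (A : comPzRingType) (n l : nat).
Implicit Types (u v w : 'M[A]_(l, n)) (t : incr n l).

Lemma incr_uniq t : uniq (val t).
Proof.
apply: (@map_uniq _ _ val); apply: (sorted_uniq ltn_trans ltnn); exact: valP t.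
Qed.

Lemma incr_mem_inj s t : {subset val s <= val t} -> s = t.
Proof.
move=> st; apply/val_inj/val_inj.
have [|_ eqst] := uniq_min_size (incr_uniq s) st; first by rewrite !size_tuple.
apply: (inj_map val_inj); apply: (irr_sorted_eq ltn_trans ltnn (valP s) (valP t)).
exact: eq_mem_map.
Qed.

Lemma wedge_basisE t : wedge_basis A (tnth (val t)) = free_basis A t.
Proof.
apply/ffunP => s; rewrite !ffunE; case: eqVneq => [->|nst].
  rewrite -[RHS](det1 A l); congr (\det _); apply/matrixP => i j.
  by rewrite !mxE (inj_eq (tuple_uniqP _ (incr_uniq t))).
have /allPn[k /tnthP[i ->] kNs] : ~~ all (mem (val s)) (val t).
  apply: contra_neqN nst => /allP ts; exact/esym/incr_mem_inj.
rewrite (expand_det_row _ i) big1 // => j _; rewrite !mxE.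
case: eqP => [tij|]; last by rewrite mul0r.
by case/negP: kNs; rewrite inE tij mem_tnth.
Qed.

Lemma koszul_diff_basis (x : n.-tuple A) t :
  koszul_diff x (wedge_basis A (tnth (val t))) =
  \sum_(j < l) ((-1) ^+ j * tnth x (tnth (val t) j)) *:
    wedge_basis A (fun i : 'I_l.-1 => tnth (val t) (lift j i)).
Proof.
rewrite wedge_basisE /koszul_diff (bigD1 t) //= [X in _ + X]big1 => [|s /negPf st].
  by rewrite addr0 ffunE eqxx scale1r.
by rewrite ffunE st scale0r.
Qed.

Lemma koszul_diff_linear (x : n.-tuple A) : linear (@koszul_diff A n x l).
Proof.
move=> a c c'; rewrite /koszul_diff scaler_sumr -big_split; apply: eq_bigr => t _.
by rewrite /= !ffunE scalerDl scalerA.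
Qed.

Lemma wedge_multilinear : multilinear (@wedge A n l).
Proof.
move=> u v w i b c /rowP ri /matrixP r1 /matrixP r2; apply/ffunP => t; rewrite !ffunE.
apply: (determinant_multilinear (i0 := i)).
- by apply/rowP => k; have := ri (tnth (val t) k); rewrite !mxE.
- by apply/matrixP => k p; have := r1 k (tnth (val t) p); rewrite !mxE.
- by apply/matrixP => k p; have := r2 k (tnth (val t) p); rewrite !mxE.
Qed.

Lemma wedge_alternating : alternating (@wedge A n l).
Proof.
move=> v i j ij /rowP eij; apply/ffunP => t; rewrite !ffunE.
apply: (determinant_alternate ij) => k.
by have := eij (tnth (val t) k); rewrite !mxE.
Qed.

Section Alternating.
Variables (V : lmodType A) (g : 'M[A]_(l, n) -> V).
Hypotheses (g_lin : multilinear g) (g_alt : alternating g).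

Let upd v (i : 'I_l) (r : 'rV[A]_n) : 'M[A]_(l, n) :=
  \matrix_(k, j) (if k == i then r 0 j else v k j).

Let upd_linear v i : linear (fun r => g (upd v i r)).
Proof.
move=> a r r'; rewrite -[g (upd v i r') in RHS]scale1r; apply: (g_lin (i := i)).
- by apply/rowP => k; rewrite !mxE eqxx mul1r.
- by apply/matrixP => k p; rewrite !mxE eq_sym (negPf (neq_lift _ _)).
- by apply/matrixP => k p; rewrite !mxE eq_sym (negPf (neq_lift _ _)).
Qed.

Let upd_row v i : upd v i (row i v) = v.
Proof. by apply/matrixP => k p; rewrite !mxE; case: eqP => // ->. Qed.

Let alternating_xrow v (i j : 'I_l) : g v = 0 -> g (xrow i j v) = 0.
Proof.
have [->|ij gv0] := eqVneq i j; first by rewrite /xrow tperm1 row_perm1.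
have ji : (j == i) = false by rewrite eq_sym (negPf ij).
pose w r r' := upd (upd v i r) j r'.
have w0 r : g (w r r) = 0.
  by apply: (g_alt ij); apply/rowP => k; rewrite !mxE eqxx (negPf ij) eqxx.
have wC r r' : w r r' = upd (upd v j r') i r.
  by apply/matrixP => k p; rewrite !mxE; have [->|] := eqVneq k j; rewrite ?ji.
have wDl r1 r2 r : g (w (r1 + r2) r) = g (w r1 r) + g (w r2 r).
  by rewrite !wC -[r1 in LHS]scale1r upd_linear scale1r.
have wDr r1 r2 r : g (w r (r1 + r2)) = g (w r r1) + g (w r r2).
  by rewrite /w -[r1 in LHS]scale1r upd_linear scale1r.
have := w0 (row i v + row j v); rewrite wDl !wDr !w0 add0r addr0.
have -> : w (row i v) (row j v) = v.
  apply/matrixP => k p; rewrite !mxE.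
  by case: eqP => [->|_] //; case: eqP => [->|].
rewrite gv0 add0r => <-; congr g; apply/matrixP => k p; rewrite !mxE.
by case: tpermP => [->|->|/eqP/negPf-> /eqP/negPf->]; rewrite ?eqxx ?(negPf ij).
Qed.

Let alternating_row_perm v (s : 'S_l) : g v = 0 -> g (row_perm s v) = 0.
Proof.
have [ts -> _] := prod_tpermP s; elim: ts => [|p ts IHts] gv0.
  by rewrite big_nil row_perm1.
by rewrite big_cons row_permM; apply/alternating_xrow/IHts.
Qed.

Lemma alternating_eq0 :
  (forall t, g (rowsub (tnth (val t)) 1%:M) = 0) -> forall v, g v = 0.
Proof.
move=> g0.
have gb0 (phi : 'I_l -> 'I_n) : g (rowsub phi 1%:M) = 0.
  have [/injectiveP phi_inj|/injectivePn[i [j ij eij]]] := boolP (injectiveb phi).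
    pose e := [tuple phi i | i < l].
    have sz : size (sort (fun i j : 'I_n => i <= j)%N e) == l.
      by rewrite size_sort size_tuple.
    have leT : total (fun i j : 'I_n => i <= j)%N by move=> i j; exact: leq_total.
    have lt_s : sorted ltn (map val (Tuple sz)).
      rewrite ltn_sorted_uniq_leq (map_inj_uniq val_inj) sort_uniq.
      by rewrite sorted_map (sort_sorted leT) andbT map_inj_uniq ?enum_uniq.
    have /tuple_permP[s es] : perm_eq e (Tuple sz).
      by rewrite perm_sym perm_sort.
    rewrite (_ : rowsub _ _ =
      row_perm s (rowsub (tnth (val (exist _ (Tuple sz) lt_s : incr n l))) 1%:M)).
      exact/alternating_row_perm/g0.
    have phis i : phi i = tnth (Tuple sz) (s i).
      by rewrite -(tnth_mktuple phi) -(tnth_mktuple (fun i => tnth _ (s i)));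
        congr tnth; apply/val_inj.
    by apply/matrixP => i j; rewrite !mxE phis.
  by apply: (g_alt ij); apply/rowP => k; rewrite !mxE eij.
suff gk k : forall v,
    (forall i : 'I_l, (k <= i)%N -> exists q, row i v = delta_mx 0 q) -> g v = 0.
  by move=> v; apply: (gk l v) => i; rewrite leqNgt ltn_ord.
elim: k => [|k IHk] v rv.
  have /fin_all_exists[phi rphi] i := rv i isT.
  rewrite -(gb0 phi); congr g; apply/row_matrixP => i.
  by rewrite rphi row_rowsub row1.
have [lk|kl] := leqP l k.
  by apply: IHk => i ki; have := leq_trans (ltn_ord i) lk; rewrite ltnNge ki.
pose i0 := Ordinal kl.
rewrite -(upd_row v i0) (row_sum_delta (row i0 v)).
rewrite (linear_combination _ _ _ (upd_linear v i0)).
rewrite big1 // => p _; rewrite IHk ?scaler0 // => i ki.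
have [->|ii0] := eqVneq i i0.
  by exists p; apply/rowP => q; rewrite !mxE !eqxx.
have [|q rq] := rv i; first by rewrite ltn_neqAle ki andbT eq_sym.
by exists q; rewrite -rq; apply/rowP => q'; rewrite !mxE (negPf ii0).
Qed.

End Alternating.

Lemma ffun_sum_basis (B : finType) (c : {ffun B -> A^o}) :
  c = \sum_b c b *: free_basis A b.
Proof.
apply/ffunP => b; rewrite sum_ffunE (bigD1 b) //= big1 => [|b' /negPf b'b].
  by rewrite !ffunE eqxx addr0 /GRing.scale /= mulr1.
by rewrite !ffunE eq_sym b'b scaler0.
Qed.

Theorem wedge_universal (V : lmodType A) (f : 'M[A]_(l, n) -> V) :
  multilinear f -> alternating f ->
  exists! h : exterior A n l -> V, linear h /\ forall v, h (wedge v) = f v.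
Proof.
move=> f_lin f_alt.
pose h (c : exterior A n l) := \sum_t c t *: f (rowsub (tnth (val t)) 1%:M).
have h_lin : linear h.
  move=> a c c'; rewrite /h scaler_sumr -big_split; apply: eq_bigr => t _.
  by rewrite /= !ffunE scalerDl scalerA.
have h_basis t : h (free_basis A t) = f (rowsub (tnth (val t)) 1%:M).
  rewrite /h (bigD1 t) //= big1 => [|s /negPf st].
    by rewrite addr0 ffunE eqxx scale1r.
  by rewrite ffunE st scale0r.
exists h; split=> [|h' [h'_lin h'f]].
  split=> // v; apply/eqP; rewrite -subr_eq0; apply/eqP.
  apply: (alternating_eq0 (g := fun v => h (wedge v) - f v)) => {v}.
  - move=> u v w i b c ru rv rw; rewrite (f_lin _ _ _ _ _ _ ru rv rw).
    rewrite (wedge_multilinear ru rv rw) h_lin -[c *: wedge w]addr0 h_lin.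
    have -> : h 0 = 0 by apply: big1 => t _; rewrite ffunE scale0r.
    by rewrite addr0 !scalerBr opprD addrACA.
  - move=> v i j ij eij; rewrite (f_alt _ _ _ ij eij) subr0.
    rewrite (wedge_alternating ij eij).
    by apply: big1 => t _; rewrite ffunE scale0r.
  - by move=> t; rewrite -/(wedge_basis A _) wedge_basisE h_basis subrr.
apply/funext => c; rewrite (ffun_sum_basis c) !linear_combination //.
by apply: eq_bigr => t _; rewrite h_basis -h'f -/(wedge_basis A _) wedge_basisE.
Qed.

End ExteriorTheory.

Section TensorTheory.
Variables (A : comPzRingType) (B : finType) (M : lmodType A).

Lemma tens_bilinear : bilinear (@tens A B M).
Proof.
split=> [m a c c'|c a m m']; apply/ffunP => b; rewrite !ffunE.
  by rewrite scalerDl scalerA.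
by rewrite scalerDr !scalerA mulrC.
Qed.

Lemma ffun_sum_tens (u : {ffun B -> M}) : u = \sum_b tens (free_basis A b) (u b).
Proof.
apply/ffunP => b; rewrite sum_ffunE (bigD1 b) //= big1 => [|b' /negPf b'b].
  by rewrite !ffunE eqxx scale1r addr0.
by rewrite !ffunE eq_sym b'b scale0r.
Qed.

Theorem tens_universal (V : lmodType A) (g : {ffun B -> A^o} -> M -> V) :
  bilinear g ->
  exists! h : {ffun B -> M} -> V, linear h /\ forall c m, h (tens c m) = g c m.
Proof.
move=> [gl gr]; exists (fun u => \sum_b g (free_basis A b) (u b)).
split=> [|h' [h'_lin h'g]].
  split=> [a u u'|c m].
    rewrite scaler_sumr -big_split; apply: eq_bigr => b _.
    by rewrite /= !ffunE gr.
  rewrite {2}(ffun_sum_basis c) (linear_combination _ _ _ (gl m)).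
  apply: eq_bigr => b _; rewrite ffunE -[c b *: m]addr0 gr.
  have -> : g (free_basis A b) 0 = 0; last by rewrite addr0.
  have := linear_combination [::] (fun i : 'I_0 => 0) (fun=> 0) (gr (free_basis A b)).
  by rewrite !big_nil.
apply/funext => u; rewrite {2}(ffun_sum_tens u).
under [in RHS]eq_bigr do rewrite -[tens _ _]scale1r.
rewrite (linear_combination _ _ _ h'_lin); apply: eq_bigr => b _.
by rewrite scale1r h'g.
Qed.

Lemma tens_map_tens (C : finType) (f : {ffun B -> A^o} -> {ffun C -> A^o}) :
  linear f -> forall c (m : M), tens_map f (tens c m) = tens (f c) m.
Proof.
move=> f_lin c m; rewrite {2}(ffun_sum_basis c) (linear_combination _ _ _ f_lin).
apply/ffunP => d; rewrite /tens_map !ffunE !sum_ffunE scaler_suml.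
by apply: eq_bigr => b _; rewrite !ffunE scalerA mulrC.
Qed.

Lemma tens_map_linear (C : finType) (f : {ffun B -> A^o} -> {ffun C -> A^o}) :
  linear (tens_map f (M := M)).
Proof.
move=> a u u'; rewrite /tens_map scaler_sumr -big_split; apply: eq_bigr => b _.
by apply/ffunP => d; rewrite /= !ffunE scalerDr !scalerA mulrC.
Qed.

End TensorTheory.

(* [koszul_sub l N] is the image of [K_l(x)] tensored with [N]. *)
Lemma koszul_subE (A : comPzRingType) (n l : nat) (M : lmodType A) (N : set M) :
  is_submodule N ->
  koszul_sub n l N =
  [set u | exists k (c : 'I_k -> exterior A n l) (m : 'I_k -> M),
     (forall i, N (m i)) /\ u = \sum_i tens (c i) (m i)].
Proof.
move=> [N0 NL]; rewrite predeqE => u; split=> [uN|[k [c [m [mN ->]]]] t].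
  pose e (i : 'I_#|{: incr n l}|) := enum_val i.
  exists _, (fun i => free_basis A (e i)), (fun i => u (e i)).
  split=> [i|]; first exact: uN.
  rewrite {1}(ffun_sum_tens u) (reindex e) //.
  exact/onW_bij/enum_val_bij.
rewrite sum_ffunE; elim/big_ind: _ => [|v w vN wN|i _]; first by rewrite inE in N0.
  by have := NL 1 v w; rewrite scale1r !inE; apply.
by have := NL (c i t) (m i) 0; rewrite addr0 ffunE !inE; apply => //; rewrite inE in N0.
Qed.

(* Main.v *)
(* In degree [l >= 1], fix [t = {t_0 < ... < t_(l-1)}] and let
   [s = t \ {t_0}]. The [s]-coordinate of [d u] is a combination
   [\sum_i x_i m_i] where [m_i] is, up to sign, the coordinate of [u] at
   [s + i] (zero if [i] is in [s]), and [m_(t_0) = u_t]. If [d u] lies in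
   [J K(N)], this combination equals [\sum_i x_i v_i] with [v_i] in [N], so by
   independence [u_t - v_(t_0)] lies in [J M]. The converse is the same
   formula for [l = 1]. *)
Require Import Defs.
From mathcomp Require Import all_boot all_order all_algebra.
From mathcomp Require Import boolp classical_sets.

Import GRing.Theory.
Local Open Scope ring_scope.
Local Open Scope classical_set_scope.

Lemma is_submoduleP {A : pzRingType} {M : lmodType A} {N : set M} :
  is_submodule N <->
  N 0 /\ forall (a : A) (u v : M), N u -> N v -> N (a *: u + v).
Proof.
split=> [[N0 NL]|[N0 NL]].
  by split=> [|a u v Nu Nv]; [rewrite inE in N0|
    have := NL a u v; rewrite !inE; apply].
by split=> [|a u v]; rewrite !inE //; exact: NL.
Qed.

Lemma is_submodule_sum {A : pzRingType} {M : lmodType A} {N : set M}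
    (I : Type) (r : seq I) (c : I -> A) (u : I -> M) :
  is_submodule N -> (forall i, N (u i)) -> N (\sum_(i <- r) c i *: u i).
Proof.
move=> /is_submoduleP[N0 NL] Nu.
by elim: r => [|i r IHr]; rewrite ?big_nil // big_cons; apply: NL.
Qed.

Lemma is_submodule_setT {A : pzRingType} (M : lmodType A) :
  is_submodule [set: M].
Proof. by apply/is_submoduleP. Qed.

Lemma is_submodule_set0 {A : pzRingType} (M : lmodType A) :
  is_submodule [set (0 : M)].
Proof.
by apply/is_submoduleP; split=> // a u v /= -> ->; rewrite scaler0 addr0.
Qed.

Section IdealMul.
Context {A : comPzRingType} {n : nat} (x : n.-tuple A).

(** Expanding each ideal coefficient in the generators and regrouping by generator leaves one vector
    per [tnth x i]; this vector stays in [N] because [N] is a submodule. *)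
Lemma ideal_mul_genP {M : lmodType A} {N : set M} (w : M) :
  is_submodule N ->
  ideal_mul (ideal_gen x) N w <->
  exists2 m : 'I_n -> M, forall i, N (m i) & w = \sum_i tnth x i *: m i.
Proof.
move=> subN; split=> [[k [a [u [Ja Nu ->]]]]|[m Nm ->]].
  have [c ac] := fin_all_exists Ja.
  exists (fun i => \sum_j c j i *: u j) => [i|].
    exact: is_submodule_sum.
  under [RHS]eq_bigr do rewrite scaler_sumr.
  rewrite exchange_big; apply: eq_bigr => j _; rewrite ac scaler_suml.
  by apply: eq_bigr => i _; rewrite scalerA mulrC.
exists n, (tnth x), m; split=> // i.
(* Kronecker coefficients exhibit [tnth x i] as an element of the ideal. *)
exists (fun j => (j == i)%:R); rewrite (bigD1 i) //= eqxx mul1r big1 ?addr0 //.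
by move=> j /negPf->; rewrite mul0r.
Qed.

Lemma is_submodule_koszul_sub {M : lmodType A} {N : set M} (l : nat) :
  is_submodule N -> is_submodule (koszul_sub n l N).
Proof.
move=> /is_submoduleP[N0 NL]; apply/is_submoduleP; split=> [t|a u v Nu Nv t].
  by rewrite ffunE.
by rewrite !ffunE; apply: NL.
Qed.

Lemma koszul_subT {M : lmodType A} (l : nat) :
  koszul_sub n l [set: M] = [set: koszul n M l].
Proof. by rewrite predeqE. Qed.

(** By [ideal_mul_genP] every coordinate is decomposed along the same [n] generators, so the
    coordinatewise decompositions assemble into a single one. *)
Lemma ideal_mul_koszul_subP {M : lmodType A} {N : set M} (l : nat)
    (u : koszul n M l) :
  is_submodule N ->
  ideal_mul (ideal_gen x) (koszul_sub n l N) u <->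
  forall t, ideal_mul (ideal_gen x) N ((u : {ffun incr n l -> M}) t).
Proof.
move=> subN; have subKN := is_submodule_koszul_sub l subN.
split=> [/(ideal_mul_genP _ subKN)[m Nm ->] t|Ju].
  apply/(ideal_mul_genP _ subN).
  exists (fun i => (m i : {ffun incr n l -> M}) t) => [i|]; first exact: Nm.
  by rewrite sum_ffunE; apply: eq_bigr => i _; rewrite ffunE.
have /fin_all_exists2[m Nm um] t := (ideal_mul_genP _ subN).1 (Ju t).
apply/(ideal_mul_genP _ subKN).
exists (fun i => [ffun t => m t i]) => [i t|]; first by rewrite ffunE.
apply/ffunP => t; rewrite um sum_ffunE.
by apply: eq_bigr => i _; rewrite !ffunE.
Qed.

End IdealMul.

Section Faces.
Context {n l : nat}.
Implicit Types (t : incr n l) (j : 'I_l).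

Lemma incr_tnth_lt t (i j : 'I_l) :
  (i < j)%N -> (tnth (val t) i < tnth (val t) j)%N.
Proof.
move=> ij; have := sorted_ltn_nth ltn_trans 0%N (valP t) i j.
rewrite !inE !size_map !size_tuple => /(_ (ltn_ord i) (ltn_ord j) ij).
by rewrite !(nth_map (tnth (val t) i)) ?size_tuple // -!tnth_nth.
Qed.

Fact face_subproof t j :
  sorted ltn (map val [tuple tnth (val t) (lift j i) | i < l.-1]).
Proof.
rewrite /= -map_comp sorted_map.
apply: (@sub_sorted _ (relpre val ltn)) => [i k /= ik|].
  (* [lift j] is strictly increasing, so skipping position [j] preserves the order. *)
  by apply: incr_tnth_lt; rewrite ltnNge leq_bump2 -ltnNge.
by rewrite -sorted_map val_enum_ord iota_ltn_sorted.
Qed.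

Definition face t j : incr n l.-1 :=
  exist _ [tuple tnth (val t) (lift j i) | i < l.-1] (face_subproof t j).

Lemma tnth_face t j i : tnth (val (face t j)) i = tnth (val t) (lift j i).
Proof. exact: tnth_mktuple. Qed.

(** An increasing tuple is determined by its set of entries, here the face together with the removed
    entry. *)
Lemma face_inj (s t : incr n l) (j k : 'I_l) :
  tnth (val s) j = tnth (val t) k -> face s j = face t k -> s = t /\ j = k.
Proof.
move=> ejk eface; have st : s = t.
  apply: incr_mem_inj => _ /tnthP[i ->].
  case: (unliftP j i) => [i' ->|->]; last by rewrite ejk mem_tnth.
  by rewrite -tnth_face eface tnth_face mem_tnth.
split=> //; move: ejk; rewrite st; apply/tuple_uniqP; exact: incr_uniq.
Qed.

End Faces.

Section Coordinates.
Context {A : comPzRingType} {n : nat} (x : n.-tuple A) {M : lmodType A}.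

(** Faces are again increasing, so each wedge in the differential is already a basis vector and no
    reordering sign appears. *)
Lemma koszul_diff_free_basis {l : nat} (t : incr n l) :
  koszul_diff x (free_basis A t) =
  \sum_(j < l) ((-1) ^+ j * tnth x (tnth (val t) j)) *: free_basis A (face t j).
Proof.
rewrite -wedge_basisE koszul_diff_basis; apply: eq_bigr => j _.
rewrite -wedge_basisE; congr (_ *: wedge_basis A _).
by apply/funext => i; rewrite tnth_face.
Qed.

(** By [face_inj] at most one pair [(t, j)] contributes; writing a sum makes the value zero when [i]
    already occurs in [s], without a case split. *)
Definition cofaces {l : nat} (u : {ffun incr n l -> M}) (s : incr n l.-1)
    (i : 'I_n) : M :=
  \sum_(t : incr n l) \sum_(j < l | (face t j == s) && (tnth (val t) j == i))
    (-1) ^+ j *: u t.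

(** The terms of the differential are sorted by the removed entry: a pair [(t, j)] counts only for
    [i = tnth (val t) j]. *)
Lemma koszul_diffME {l : nat} (u : {ffun incr n l -> M}) (s : incr n l.-1) :
  (koszul_diffM x M l u : {ffun incr n l.-1 -> M}) s =
  \sum_i tnth x i *: cofaces u s i.
Proof.
under [RHS]eq_bigr do rewrite scaler_sumr.
rewrite exchange_big sum_ffunE; apply: eq_bigr => t _.
rewrite ffunE koszul_diff_free_basis sum_ffunE scaler_suml.
under [RHS]eq_bigr do rewrite scaler_sumr big_mkcond.
rewrite exchange_big; apply: eq_bigr => j _ /=.
rewrite (bigD1 (tnth (val t) j)) //= big1 ?addr0 => [|i /negPf].
  rewrite eqxx andbT !ffunE (eq_sym s); case: eqP => _.
    by rewrite [X in X *: u t]mulr1 mulrC scalerA.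
  by rewrite scaler0 scale0r.
by rewrite eq_sym => ->; rewrite andbF.
Qed.

(** The only contributing pair is [(t, ord0)], whose sign is [+1]. *)
Lemma cofaces_face {l : nat} (u : {ffun incr n l.+1 -> M}) (t : incr n l.+1) :
  cofaces u (face t ord0) (tnth (val t) ord0) = u t.
Proof.
rewrite /cofaces (bigD1 t) //= [X in _ + X]big1 => [|s st].
  rewrite addr0 (bigD1 ord0) ?eqxx //= scale1r big1 ?addr0 // => j.
  by case/andP=> /andP[/eqP ef /eqP ei]; have [_ ->] := face_inj _ _ _ _ ei ef.
apply: big1 => j /andP[/eqP ef /eqP ei].
by have [/eqP] := face_inj _ _ _ _ ei ef; rewrite (negPf st).
Qed.

Lemma independent_preimage {N : set M} (l : nat) :
  independent x M -> is_submodule N -> (0 < l)%N ->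
  koszul_diffM x M l @^-1` ideal_mul (ideal_gen x) (koszul_sub n l.-1 N)
    `<=` add_set (koszul_sub n l N)
           (ideal_mul (ideal_gen x) [set: koszul n M l]).
Proof.
move=> indep subN; case: l => // l _ u.
move=> /(ideal_mul_koszul_subP _ _ _ subN) Jdu.
(* The correction in [N] is found for each [t] separately, from the face without its first entry. *)
have /fin_all_exists2[v Nv Juv] (t : incr n l.+1) : exists2 v : M,
    N v & ideal_mul (ideal_gen x) [set: M] ((u : {ffun _ -> M}) t - v).
  have /(ideal_mul_genP _ _ subN)[m Nm] := Jdu (face t ord0).
  rewrite koszul_diffME => /eqP; rewrite -subr_eq0 -sumrB => /eqP dum.
  exists (m (tnth (val t) ord0)) => //; rewrite -(cofaces_face u t).
  apply: (indep (fun i => cofaces u (face t ord0) i - m i)).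
  by rewrite -[RHS]dum; apply: eq_bigr => i _; rewrite scalerBr.
exists [ffun t => v t], (u - [ffun t => v t] : {ffun incr n l.+1 -> M}).
split=> [t||]; first by rewrite ffunE.
  rewrite -koszul_subT; apply/ideal_mul_koszul_subP => [|t].
    exact: is_submodule_setT.
  by rewrite !ffunE.
by rewrite addrC subrK.
Qed.

End Coordinates.

Theorem proposition3p1 (A : comPzRingType) (n : nat) (x : n.-tuple A)
    (M : lmodType A) :
  (independent x M ->
     (forall l : nat, (1 <= l <= n)%N ->
        koszul_diffM x M l @^-1` [set 0]
          `<=` ideal_mul (ideal_gen x) [set: koszul n M l])
     /\
     (forall N : set M, is_submodule N ->
      forall l : nat, (1 <= l <= n)%N ->
        koszul_diffM x M l
            @^-1` ideal_mul (ideal_gen x) (koszul_sub n l.-1 N)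
          `<=` add_set (koszul_sub n l N)
                 (ideal_mul (ideal_gen x) [set: koszul n M l])))
  /\
  (koszul_diffM x M 1 @^-1` [set 0]
     `<=` ideal_mul (ideal_gen x) [set: koszul n M 1] ->
   independent x M).
Proof.
split=> [indep|ker1].
  split=> [l /andP[l_gt0 _] u /= du0|N subN l /andP[l_gt0 _]]; last first.
    exact: independent_preimage.
  (* The kernel statement is the case [N = 0], where [koszul_sub n l N] is zero. *)
  have sub0 := is_submodule_set0 M.
  have [|v [w [v0 Jw ->]]] := independent_preimage x l indep sub0 l_gt0 u.
    apply/(ideal_mul_genP _ _ (is_submodule_koszul_sub _ sub0)).
    exists (fun=> 0) => [i t|]; first by rewrite ffunE.
    by rewrite du0 big1 // => i _; rewrite scaler0.
  by rewrite (_ : v = 0) ?add0r //; apply/ffunP => t; rewrite v0 ffunE.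
move=> m xm0 i; pose u : {ffun incr n 1 -> M} := [ffun t => m (tnth (val t) ord0)].
(* In degree 1 the only face is the empty tuple, and its coface along [k] is the singleton [k]. *)
have cofacesE s k : cofaces u s k = m k.
  pose t : incr n 1 := exist _ [tuple k] isT.
  have -> : s = face t ord0 by apply/val_inj; rewrite tuple0 [RHS]tuple0.
  by have := cofaces_face u t; rewrite ffunE !(tnth_nth k).
have /ker1 : koszul_diffM x M 1 u = 0.
  apply/ffunP => s; rewrite koszul_diffME ffunE -[RHS]xm0.
  by apply: eq_bigr => k _; rewrite cofacesE.
rewrite -koszul_subT => /(ideal_mul_koszul_subP _ _ _ (is_submodule_setT M)).
by move=> /(_ (exist _ [tuple i] isT)); rewrite ffunE (tnth_nth i).
Qed.
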